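(* Let $\{f_i\}_{i\in I}$ be a frame for a separable Hilbert space $\mathcal H$ with frame operator $S$. Then for any $\lambda\in\mathbb R$, all $J\subset I$ and any $f\in\mathcal H$, $$\left(2\lambda-\frac{\lambda^2}{2}-1\right)\sum_{i\in J}|\langle f,f_i\rangle|^2+\left(1-\frac{\lambda^2}{2}\right)\sum_{i\in J^c}|\langle f,f_i\rangle|^2\le\sum_{i\in I}|\langle S^{-1}S_Jf,f_i\rangle|^2+\sum_{i\in I}|\langle S^{-1}S_{J^c}f,f_i\rangle|^2\le\sum_{i\in I}|\langle f,f_i\rangle|^2.$$
   Context: Hilbert spaces are complex and $I$ is a countable index set. A sequence $\{f_i\}_{i\in I}$ in $\mathcal H$ is a frame for $\mathcal H$ if there are constants $A,B>0$ with $A\|f\|^2\le\sum_{i\in I}|\langle f,f_i\rangle|^2\le B\|f\|^2$ for all $f\in\mathcal H$. Its frame operator is $S:\mathcal H\to\mathcal H$, $Sf=\sum_{i\in I}\langle f,f_i\rangle f_i$, which is bounded, self-adjoint, positive and invertible. For $J\subset I$, $J^c=I\setminus J$ and $S_Jf=\sum_{i\in J}\langle f,f_i\rangle f_i$. *)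

(* Defs.v *)
From mathcomp Require Import all_boot all_order all_algebra finmap.
From mathcomp Require Import all_classical all_reals all_analysis.
From mathcomp.real_closed Require Import complex.
From mathcomp.analysis.showcase Require Import summability.

Set Implicit Arguments.
Unset Strict Implicit.
Unset Printing Implicit Defensive.

Import Order.TTheory GRing.Theory Num.Theory.
Import numFieldNormedType.Exports.

Local Open Scope classical_set_scope.
Local Open Scope ring_scope.
Local Open Scope complex_scope.

Definition separable_space (T : topologicalType) : Prop :=
  exists2 D : set T, countable D & dense D.

Section Frames.
Context {R : realType} {H : completeNormedModType R[i]} {I : countType}.
Implicit Types (ip : {dot H for Num.conj}) (fr : I -> H) (J : set I) (f : H).

(* Inner products are linear in the first argument, conjugate-linear in the
   second. *)
Definition induces_norm ip : Prop := forall x, `|x| = sqrtC (ip x x).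

(* Norms have values in R[i]; [complex.Re] brings them back to R. *)
Definition sqcoef_sum ip fr J f : \bar R :=
  \esum_(i in J) ((complex.Re `|ip f (fr i)|) ^+ 2)%:E.

Definition is_frame ip fr : Prop :=
  exists A B : R, [/\ 0 < A, 0 < B & forall f : H,
    ((A * complex.Re `|f| ^+ 2)%:E <= sqcoef_sum ip fr setT f)%E /\
    (sqcoef_sum ip fr setT f <= (B * complex.Re `|f| ^+ 2)%:E)%E].

(* [sum] is the limit in H of the finite partial sums along the directed set of
   finite subsets of I; the terms outside J are replaced by 0. *)
Definition partial_frame_op ip fr J f : H :=
  sum (fun i => if i \in J then ip f (fr i) *: fr i else 0).

Definition frame_op ip fr : H -> H := partial_frame_op ip fr setT.

(* [pinv setT S] is the two-sided inverse of S whenever S is bijective. *)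
Definition inv_frame_op ip fr : H -> H := pinv setT (frame_op ip fr).

End Frames.

(* Main.v *)
Require Import Defs.
From mathcomp Require Import all_boot all_order all_algebra finmap.
From mathcomp Require Import all_classical all_reals all_analysis.
From mathcomp.real_closed Require Import complex.
From mathcomp.analysis.showcase Require Import summability.
From mathcomp Require Import lra.

(** Write <.,.> for the real part of the inner product and, for a set K of
indices, b_K(x, y) = <S_K x, y>, where S_K x is the sum over i in K of
(x, f_i) f_i.  Each b_K is a symmetric real bilinear form, and b_K(x, x) is the
sum over K of |(x, f_i)|^2, hence it is nonnegative.  Call
N(x) = b_I(x, x) the energy of x.

Let u = S^-1 S_J f and v = S^-1 S_J^c f.  Then u + v = f because
S_J + S_J^c = S, and b_I(u, f) = <S_J f, f> = b_J(f, f); expanding N(f - u)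
gives
  N(u) + N(v) = 2 N(u) - 2 b_J(f, f) + N(f)            ([energy_split]),
so that both inequalities are statements about N(u) alone:
- upper bound: N(u) = <S_J f, u> = b_J(f, u), and positivity of b_J at f - u
  bounds this by (b_J(f, f) + b_J(u, u)) / 2 <= (b_J(f, f) + N(u)) / 2, so
  N(u) <= b_J(f, f) ([energy_le]);
- lower bound: N((lambda / 2) f - u) >= 0 reads
  N(u) >= lambda b_J(f, f) - (lambda^2 / 4) N(f) ([energy_ge]).

Three analytic facts support this.  The series S_K x converges along the finite
sets of indices: by the Bessel bound, the squared norms of its finite sums are
dominated by finite sums of a bounded nonnegative series ([cvg_frame_op]).
The symmetry of b_K passes from finite sums to the limit, and gives the
linearity of S_K ([frame_op_sym], [frame_opD]).  Finally S is bijective: with frame bounds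
A and B, it is bounded below, hence injective, and for t = A / B^2 the operator
t S differs from the identity by a map of norm less than 1, hence it is
surjective ([surjective_near_id]). *)

Set Implicit Arguments.
Unset Strict Implicit.
Unset Printing Implicit Defensive.

Import Order.TTheory GRing.Theory Num.Theory.
Import numFieldNormedType.Exports.

Local Open Scope classical_set_scope.
Local Open Scope ring_scope.
Local Open Scope complex_scope.

(** * Norms of complex normed spaces as real numbers *)

(** The norm of a complex normed space has values in [R[i]]; real values allow
ordered-field reasoning and infima. *)
Definition rnorm {R : realType} {V : normedModType R[i]} (x : V) : R :=
  complex.Re `|x|.

Section RealNorm.
Context {R : realType} {V : normedModType R[i]}.
Implicit Types (x y : V) (r : R).

Lemma rnormE x : `|x| = (rnorm x)%:C.
Proof. by rewrite /rnorm RRe_real// ger0_real. Qed.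

Lemma rnorm_ge0 x : 0 <= rnorm x.
Proof. by rewrite -ler0c -rnormE. Qed.

Lemma rnorm0_eq0 x : rnorm x = 0 -> x = 0.
Proof. by move=> x0; apply: normr0_eq0; rewrite rnormE x0. Qed.

Lemma rnormD x y : rnorm (x + y) <= rnorm x + rnorm y.
Proof. by rewrite -lecR rmorphD/= -!rnormE ler_normD. Qed.

Lemma rnormN x : rnorm (- x) = rnorm x.
Proof. by rewrite /rnorm normrN. Qed.

Lemma cvg_rnormP T (F : set_system T) {FF : Filter F} (g : T -> V) x :
  g @ F --> x <-> forall e : R, 0 < e -> \forall t \near F, rnorm (x - g t) < e.
Proof.
split=> [/cvgrPdist_lt gx e e0|gx].
  have : (0 : R[i]) < e%:C by rewrite ltcR.
  by move=> /gx; apply: filterS => t; rewrite rnormE ltcR.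
apply/cvgrPdist_lt => e e0.
have eE : e = (complex.Re e)%:C by rewrite RRe_real// gtr0_real.
have {}e0 : 0 < complex.Re e by rewrite -ltcR -eE.
by move/gx : e0; apply: filterS => t; rewrite rnormE eE ltcR.
Qed.

End RealNorm.

Lemma cvg_rnorm_cauchy {R : realType} {V : completeNormedModType R[i]}
    (F : set_system V) {FF : ProperFilter F} :
  (forall e : R, 0 < e -> exists x, F [set y | rnorm (x - y) < e]) -> cvg F.
Proof.
move=> Fe; apply: cauchy_cvg; apply: cauchy_exP => e e0.
have eE : e = (complex.Re e)%:C by rewrite RRe_real// gtr0_real.
have : 0 < complex.Re e by rewrite -ltcR -eE.
move=> /Fe[x Fx]; exists x; apply: filterS Fx => y /=.
by rewrite -ball_normE/= rnormE eE ltcR.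
Qed.

(** The fixed point principle for [id - T], phrased through approximate
solutions.  Replacing [x] by [x + (y - T x)] multiplies the residual [y - T x]
by at most [q], so the residuals have infimum 0.  As [T] is bounded below, the sets of
[e]-approximate solutions have diameters tending to 0: they generate a Cauchy
filter, whose limit solves the equation. *)
Lemma surjective_near_id {R : realType} {V : completeNormedModType R[i]}
    (T : V -> V) (q : R) :
  q < 1 -> {morph T : x y / x + y} ->
  (forall x, rnorm (x - T x) <= q * rnorm x) ->
  forall y, exists x, T x = y.
Proof.
move=> q1 TD Tq y.
have T0 : T 0 = 0 by apply: (addrI (T 0)); rewrite -TD !addr0.
have TN x : T (- x) = - T x.
  by apply: (addrI (T x)); rewrite -TD !subrr T0.
have TB x z : T (x - z) = T x - T z by rewrite TD TN.
have q0 : 0 <= `|q| by [].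
have Tle x : rnorm (T x) <= (1 + `|q|) * rnorm x.
  have -> : T x = x - (x - T x) by rewrite opprB addrC subrK.
  apply: le_trans (rnormD _ _) _; rewrite rnormN.
  have := Tq x; have := rnorm_ge0 x; have := ler_norm q; nra.
have Tge x : (1 - q) * rnorm x <= rnorm (T x).
  have := rnormD (x - T x) (T x); rewrite subrK; have := Tq x; lra.
pose U (e : R) := [set x | rnorm (y - T x) < e].
have Une e : 0 < e -> U e !=set0.
  move=> e0; pose A := [set rnorm (y - T x) | x in [set: V]].
  have infA : has_inf A.
    split; first by exists (rnorm (y - T 0)), 0.
    by exists 0 => _ [x _ <-]; exact: rnorm_ge0.
  rewrite /U; apply: contrapT => U0.
  have Age x : e <= rnorm (y - T x).
    by rewrite leNgt; apply/negP => xe; apply: U0; exists x.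
  have infe : e <= inf A by apply: lb_le_inf => [|_ [x _ <-]//]; case: infA.
  (* the residual at x + (y - T x) is the image of y - T x under id - T *)
  have infq x : inf A <= q * rnorm (y - T x).
    apply: le_trans (Tq _); apply: ge_inf; first by case: infA.
    by exists (x + (y - T x)) => //; rewrite TD opprD addrA.
  have [d d0 qd] : exists2 d, 0 < d & q * (inf A + d) < inf A.
    (* solves d (1 + |q|) = (1 - q) inf A, which leaves a gap of at least d *)
    exists ((1 - q) * inf A / (1 + `|q|)).
      by rewrite divr_gt0 ?mulr_gt0//; lra.
    rewrite mulrDr; set d := _ / _.
    have dE : d * (1 + `|q|) = (1 - q) * inf A by rewrite /d divfK//; lra.
    have d0 : 0 < d by rewrite divr_gt0 ?mulr_gt0//; lra.
    have := ler_norm q; nra.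
  have [_ [x _ <-] xd] := inf_adherent d0 infA.
  have := infq x; have := Age x.
  have [q0'|q0'] := leP 0 q; nra.
pose F : set_system V := filter_from [set e : R | 0 < e] U.
have FF : ProperFilter F.
  apply: filter_from_proper; last by move=> e /Une.
  apply: filter_from_filter; first by exists 1; exact: ltr01.
  move=> e e' /= e0 e'0; exists (Num.min e e'); first by rewrite lt_min e0.
  by move=> x; rewrite /U/= lt_min => /andP[].
have /cvg_ex[/= x Fx] : cvg F.
  apply: cvg_rnorm_cauchy => e e0.
  have e'0 : 0 < (1 - q) * e / 2 by rewrite divr_gt0// mulr_gt0// subr_gt0.
  have [x Ux] := Une _ e'0; exists x; exists ((1 - q) * e / 2) => // z Uz /=.
  have := Tge (x - z); rewrite TB.
  have -> : T x - T z = (y - T z) - (y - T x).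
    by rewrite opprB [RHS]addrC addrA subrK.
  have := rnormD (y - T z) (- (y - T x)); rewrite rnormN.
  move: Ux Uz; rewrite /U/= -[_ < e](ltr_pM2l (x := 1 - q)) ?subr_gt0//; lra.
exists x; apply/esym/subr0_eq/rnorm0_eq0/eqP.
rewrite eq_le rnorm_ge0 andbT; apply/ler_addgt0Pr => e e0; rewrite add0r.
have e'0 : 0 < e / (2 + `|q|) by rewrite divr_gt0//; lra.
have /cvg_rnormP/(_ _ e'0)[d /= d0 Ud] : (fun z => z) @ F --> x by exact: Fx.
have [z] := Une (Num.min d (e / (2 + `|q|))) ltac:(by rewrite lt_min d0).
rewrite /U/= lt_min => /andP[/Ud/= xz zy].
have -> : y - T x = (y - T z) - T (x - z) by rewrite TB opprB addrA subrK.
apply: le_trans (rnormD _ _) _; rewrite rnormN.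
have eE : e = e / (2 + `|q|) * (2 + `|q|) by rewrite divfK//; lra.
by have := Tle (x - z); nra.
Qed.

(** * The real part of an inner product *)

Lemma Re_mul_conjC {R : realType} (z w : R[i]) :
  complex.Re (z * Num.conj w) =
  complex.Re z * complex.Re w + complex.Im z * complex.Im w.
Proof. by case: z w => a b [c d] /=; rewrite mulrN opprK. Qed.

Lemma sqr_Re_norm {R : realType} (z : R[i]) :
  complex.Re `|z| ^+ 2 = complex.Re z ^+ 2 + complex.Im z ^+ 2.
Proof.
by apply: complexI; rewrite add_Re2_Im2 [LHS]rmorphXn.
Qed.

Definition rdot {R : realType} {H : completeNormedModType R[i]}
    (ip : {dot H for Num.conj}) (x y : H) : R := complex.Re (ip x y).

Section RealDot.
Context {R : realType} {H : completeNormedModType R[i]}.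
Variable ip : {dot H for Num.conj}.
Implicit Types (x y z : H) (r : R).

Lemma rdotC x y : rdot ip x y = rdot ip y x.
Proof.
have Re_conjC (z : R[i]) : complex.Re (Num.conj z) = complex.Re z by case: z.
by rewrite /rdot hermC expr0 mul1r; exact: Re_conjC.
Qed.

Lemma rdotDl x y z : rdot ip (x + y) z = rdot ip x z + rdot ip y z.
Proof. by rewrite /rdot linearDl raddfD. Qed.

Lemma rdotNl x z : rdot ip (- x) z = - rdot ip x z.
Proof. by rewrite /rdot linearNl raddfN. Qed.

Lemma rdotZl r x z : rdot ip (r%:C *: x) z = r * rdot ip x z.
Proof.
rewrite /rdot linearZl_LR/=; case: (ip x z) => a b /=.
by rewrite mul0r subr0.
Qed.

Lemma rdotDr x y z : rdot ip z (x + y) = rdot ip z x + rdot ip z y.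
Proof. by rewrite rdotC rdotDl !(rdotC z). Qed.

Lemma rdotNr x z : rdot ip z (- x) = - rdot ip z x.
Proof. by rewrite rdotC rdotNl (rdotC z). Qed.

Lemma rdotZr r x z : rdot ip z (r%:C *: x) = r * rdot ip z x.
Proof. by rewrite rdotC rdotZl (rdotC z). Qed.

Lemma rdot_suml (T : Type) (s : seq T) (g : T -> H) z :
  rdot ip (\sum_(i <- s) g i) z = \sum_(i <- s) rdot ip (g i) z.
Proof. by rewrite /rdot linear_sumlz raddf_sum. Qed.

Hypothesis ip_norm : induces_norm ip.

Lemma rdotxx x : rdot ip x x = rnorm x ^+ 2.
Proof.
rewrite /rnorm /rdot ip_norm; have ge0 := dnorm_ge0 ip x.
apply: complexI; rewrite rmorphXn/= !RRe_real ?sqrtCK//.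
  by rewrite ger0_real// sqrtC_ge0.
by rewrite ger0_real.
Qed.

Lemma rdot_eq0 x : (forall y, rdot ip x y = 0) -> x = 0.
Proof.
move=> /(_ x); rewrite rdotxx => /eqP; rewrite sqrf_eq0 => /eqP.
exact: rnorm0_eq0.
Qed.

Lemma rdot_CauchySchwarz x y : `|rdot ip x y| <= rnorm x * rnorm y.
Proof.
wlog suff : x / rdot ip x y <= rnorm x * rnorm y.
  move=> le; rewrite ler_norml lerNl le andbT.
  by rewrite -rdotNl -(rnormN x) le.
have [x0|x0] := eqVneq (rnorm x) 0.
  by rewrite x0 (rnorm0_eq0 x0) /rdot linear0l mul0r.
have [y0|y0] := eqVneq (rnorm y) 0.
  by rewrite y0 (rnorm0_eq0 y0) /rdot linear0r mulr0.
have x_gt0 : 0 < rnorm x by rewrite lt_def x0 rnorm_ge0.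
have y_gt0 : 0 < rnorm y by rewrite lt_def y0 rnorm_ge0.
have := sqr_ge0 (rnorm ((rnorm y)%:C *: x - (rnorm x)%:C *: y)).
rewrite -rdotxx !(rdotDl, rdotDr, rdotNl, rdotNr, rdotZl, rdotZr).
rewrite !rdotxx (rdotC y x) => le_xy.
by rewrite -(@ler_pM2l _ (rnorm x * rnorm y)) ?mulr_gt0//; nra.
Qed.

Lemma cvg_rdotl T (F : set_system T) {FF : Filter F} (g : T -> H) x y :
  g @ F --> x -> (fun t => rdot ip (g t) y) @ F --> rdot ip x y.
Proof.
move=> /cvg_rnormP gx; apply/cvgrPdist_lt => e e0.
have y0 := rnorm_ge0 y.
have /gx : 0 < e / (1 + rnorm y) by rewrite divr_gt0//; lra.
apply: filterS => t tlt; rewrite -rdotNl -rdotDl.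
apply: le_lt_trans (rdot_CauchySchwarz _ _) _.
have eE : e = e / (1 + rnorm y) * (1 + rnorm y) by rewrite divfK//; lra.
have := rnorm_ge0 (x - g t).
by rewrite [ltRHS]eE; nra.
Qed.

End RealDot.

(** * Sums along the directed set of finite subsets *)

#[local] Existing Instance totally_filter.

Section PartialSum.
Context {I : choiceType}.

Lemma partial_sumE (V : zmodType) (z : I -> V) (F : {fset I}) :
  partial_sum z F = \sum_(i <- F) z i.
Proof. by rewrite /partial_sum big_seq_fsetE. Qed.

Lemma partial_sumD (V : zmodType) (z w : I -> V) (F : {fset I}) :
  partial_sum (fun i => z i + w i) F = partial_sum z F + partial_sum w F.
Proof. exact: big_split. Qed.

Lemma partial_sumID (V : zmodType) (z : I -> V) (F G : {fset I}) :
  fsubset F G ->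
  partial_sum z G = partial_sum z F + partial_sum z (fsetD G F).
Proof.
move=> FG; rewrite !partial_sumE (big_fsetID _ (mem F))/=; congr (_ + _).
  apply: eq_fbigl => i; rewrite !inE/=; rewrite andb_idl//.
  by move=> iF; exact: (fsubsetP FG).
by apply: eq_fbigl => i; rewrite !inE/= andbC.
Qed.

Lemma near_totally (F : {fset I}) : \forall G \near totally, fsubset F G.
Proof. by exists F. Qed.

Lemma partial_sum_ge0 {R : realType} (a : I -> R) F :
  (forall i, 0 <= a i) -> 0 <= partial_sum a F.
Proof. by move=> a0; exact: sumr_ge0. Qed.

(** For nonnegative terms the net of finite sums is monotone, so its limit is
its supremum. *)
Lemma esum_partial_sum {R : realType} (a : I -> R) (l : R) :
  (forall i, 0 <= a i) -> partial_sum a @ totally --> l ->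
  \esum_(i in [set: I]) (a i)%:E = l%:E.
Proof.
move=> a0 /cvgrPdist_lt al; apply/eqP; rewrite eq_le; apply/andP; split.
  apply: ge_ereal_sup => /= _ [X [finX _] <-].
  rewrite fsumEFin// lee_fin fsbig_finite//= -partial_sumE.
  apply/ler_addgt0Pr => e /al aF.
  have [G [le_XG]] := filter_ex (filterI (near_totally (fset_set X)) aF).
  rewrite ltr_norml (partial_sumID _ le_XG).
  have := partial_sum_ge0 (fsetD G (fset_set X)) a0; lra.
apply/lee_addgt0Pr => e /al/filter_ex[G]; rewrite ltr_norml => /andP[_ lG].
apply: (@le_trans _ _ ((partial_sum a G)%:E + e%:E)%E).
  by rewrite -EFinD lee_fin; lra.
rewrite leeD2r//; apply: esum_ge; exists [set` G] => //.
by rewrite fsumEFin// lee_fin fsbig_finite//= set_fsetK partial_sumE.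
Qed.

Lemma partial_sum_le_esum {R : realType} (a : I -> R) F :
  ((partial_sum a F)%:E <= \esum_(i in [set: I]) (a i)%:E)%E.
Proof.
apply: esum_ge; exists [set` F] => //.
by rewrite fsumEFin// lee_fin fsbig_finite//= set_fsetK partial_sumE.
Qed.

(** Comparison criterion with squared norms.  If the finite sum of [a] over [F]
is within [e ^+ 2] of the supremum, the terms outside [F] contribute less than
[e ^+ 2] to any finite sum of [a], hence a vector of norm less than [e] to any
finite sum of [z]. *)
Lemma cvg_partial_sum_dominated {R : realType} {V : completeNormedModType R[i]}
    (z : I -> V) (a : I -> R) (M : R) :
  (forall F, rnorm (partial_sum z F) ^+ 2 <= partial_sum a F) ->
  (forall F, partial_sum a F <= M) ->
  cvg (partial_sum z @ totally).
Proof.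
move=> za aM; apply: cvg_rnorm_cauchy => e e0.
pose A := [set partial_sum a F | F in [set: {fset I}]].
have supA : has_sup A.
  by split; [exists (partial_sum a fset0), fset0|exists M => _ [F _ <-]].
have e20 : 0 < e ^+ 2 by rewrite exprn_gt0.
have [_ [F _ <-] supF] := sup_adherent e20 supA.
exists (partial_sum z F); apply: filterS (near_totally F) => G FG /=.
rewrite (partial_sumID _ FG) opprD addNKr rnormN.
rewrite -(@ltr_pXn2r _ 2)// ?nnegrE ?rnorm_ge0 ?(ltW e0)//.
apply: le_lt_trans (za _) _.
have : partial_sum a G <= sup A by apply: ub_le_sup; [case: supA|exists G].
by rewrite (partial_sumID _ FG); lra.
Qed.

End PartialSum.

(** * Partial frame operators of a Bessel sequence *)

Definition frame_term {R : realType} {H : completeNormedModType R[i]}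
    {I : countType} (ip : {dot H for Num.conj}) (fr : I -> H) (J : set I)
    (x : H) (i : I) : H :=
  if i \in J then ip x (fr i) *: fr i else 0.

Section Bessel.
Context {R : realType} {H : completeNormedModType R[i]} {I : countType}.
Variables (ip : {dot H for Num.conj}) (fr : I -> H) (B : R).
Hypotheses (ip_norm : induces_norm ip) (B_gt0 : 0 < B).
Hypothesis bessel :
  forall x, (sqcoef_sum ip fr setT x <= (B * rnorm x ^+ 2)%:E)%E.
Implicit Types (x y z : H) (J : set I) (r : R).

Local Notation S := (partial_frame_op ip fr).
Local Notation term := (frame_term ip fr).

Lemma rdot_term J x y i : rdot ip (term J x i) y =
  if i \in J then complex.Re (ip x (fr i)) * complex.Re (ip y (fr i)) +
                  complex.Im (ip x (fr i)) * complex.Im (ip y (fr i)) else 0.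
Proof.
rewrite /frame_term; case: ifP => _; last by rewrite /rdot linear0l.
rewrite /rdot linearZl_LR/= (hermC _ (fr i)) expr0 mul1r.
exact: Re_mul_conjC.
Qed.

Lemma rdot_term_ge0 J x i : 0 <= rdot ip (term J x i) x.
Proof. by rewrite rdot_term; case: ifP => _; nra. Qed.

Lemma sqcoef_sumE J x :
  sqcoef_sum ip fr J x = \esum_(i in setT) (rdot ip (term J x i) x)%:E.
Proof.
rewrite /sqcoef_sum [LHS]esum_mkcond; apply: eq_esum => i _.
by rewrite rdot_term; case: ifP => _ //; rewrite sqr_Re_norm !expr2.
Qed.

Lemma partial_sum_term_le J x F :
  partial_sum (fun i => rdot ip (term J x i) x) F <= B * rnorm x ^+ 2.
Proof.
rewrite -lee_fin; apply: le_trans (bessel x); rewrite sqcoef_sumE.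
apply: le_trans (partial_sum_le_esum _ F) _; apply: le_esum => i _.
rewrite lee_fin !rdot_term in_setT; case: ifP => // _; nra.
Qed.

(** Finite sums of the synthesis series satisfy the dual Bessel bound.  With [v]
the finite sum and [c_i] its coefficients, the squared norm of [v] is the sum of
the real parts of [c_i (f_i, v)].  Bounding each of these by the mean of [B |c_i|^2]
and [|(v, f_i)|^2 / B] and applying the Bessel inequality to [v] leaves half of
the squared norm of [v] to be absorbed in the left-hand side. *)
Lemma rnorm_partial_sum_term_le J x F :
  rnorm (partial_sum (term J x) F) ^+ 2 <=
  partial_sum (fun i => B * rdot ip (term J x i) x) F.
Proof.
set v := partial_sum (term J x) F; rewrite !partial_sumE -mulr_sumr.
set s := \sum_(i <- F) _.
have : 2 * B * rnorm v ^+ 2 <= B ^+ 2 * s + B * rnorm v ^+ 2.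
  apply: (@le_trans _ _ (B ^+ 2 * s +
    partial_sum (fun i => rdot ip (term setT v i) v) F)); last first.
    by rewrite lerD2l partial_sum_term_le.
  rewrite -(rdotxx ip_norm) {1}/v !partial_sumE rdot_suml !mulr_sumr -big_split.
  apply: ler_sum => i _ /=; rewrite !rdot_term in_setT.
  case: ifP => _; last first.
    by rewrite !mulr0 add0r addr_ge0 // -expr2 sqr_ge0.
  set a := complex.Re _; set b := complex.Re _.
  set c := complex.Im _; set d := complex.Im _.
  by have := sqr_ge0 (B * a - b); have := sqr_ge0 (B * c - d); lra.
by move=> le_v; rewrite -(ler_pM2l B_gt0); lra.
Qed.

Lemma cvg_frame_op J x : partial_sum (term J x) @ totally --> S J x.
Proof.
apply: (@cvg_partial_sum_dominated _ _ _ _ _ (B * (B * rnorm x ^+ 2))).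
  exact: rnorm_partial_sum_term_le.
move=> F; rewrite partial_sumE -mulr_sumr -partial_sumE ler_pM2l//.
exact: partial_sum_term_le.
Qed.

Lemma cvg_rdot_frame_op J x y :
  partial_sum (fun i => rdot ip (term J x i) y) @ totally -->
  rdot ip (S J x) y.
Proof.
rewrite (_ : partial_sum _ = fun F => rdot ip (partial_sum (term J x) F) y).
  by apply: cvg_rdotl => //; exact: cvg_frame_op.
by apply/funext => F; rewrite !partial_sumE rdot_suml.
Qed.

(** The finite sums are symmetric in [x] and [y] term by term. *)
Lemma frame_op_sym J x y : rdot ip (S J x) y = rdot ip (S J y) x.
Proof.
have := @cvg_rdot_frame_op J y x; rewrite (_ : (fun i => _) =
  (fun i => rdot ip (term J x i) y)); last first.
  apply/funext => i; rewrite !rdot_term; case: ifP => // _; lra.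
exact/cvg_unique/cvg_rdot_frame_op.
Qed.

Lemma sqcoef_sum_frame_op J x :
  sqcoef_sum ip fr J x = (rdot ip (S J x) x)%:E.
Proof.
rewrite sqcoef_sumE; apply: esum_partial_sum (@cvg_rdot_frame_op J x x).
by move=> i; exact: rdot_term_ge0.
Qed.

Lemma frame_op_ge0 J x : 0 <= rdot ip (S J x) x.
Proof.
rewrite -lee_fin -sqcoef_sum_frame_op sqcoef_sumE; apply: esum_ge0 => i _.
by rewrite lee_fin rdot_term_ge0.
Qed.

(** Linearity of [S_J] follows from the symmetry of [b_J] and the linearity of
the inner product, without another passage to the limit. *)
Lemma frame_opD J : {morph S J : x y / x + y}.
Proof.
move=> x y; apply/subr0_eq/(rdot_eq0 ip_norm) => z.
rewrite !(rdotDl, rdotNl) !(frame_op_sym J _ z) rdotDr; lra.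
Qed.

Lemma frame_opZ J r x : S J (r%:C *: x) = r%:C *: S J x.
Proof.
apply/subr0_eq/(rdot_eq0 ip_norm) => z.
rewrite !(rdotDl, rdotNl, rdotZl) !(frame_op_sym J _ z) rdotZr; lra.
Qed.

Lemma frame_opN J x : S J (- x) = - S J x.
Proof.
apply: (addrI (S J x)); rewrite -frame_opD !subrr.
by apply: (addrI (S J 0)); rewrite -frame_opD !addr0.
Qed.

Lemma frame_opC J x : S J x + S (~` J) x = frame_op ip fr x.
Proof.
suff cJ : partial_sum (term setT x) @ totally --> S J x + S (~` J) x.
  exact: cvg_unique cJ (@cvg_frame_op setT x).
rewrite (_ : partial_sum _ = fun F =>
    partial_sum (term J x) F + partial_sum (term (~` J) x) F).
  by apply: cvgD; exact: cvg_frame_op.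
apply/funext => F; rewrite -partial_sumD; congr partial_sum.
apply/funext => i; rewrite /frame_term in_setC in_setT.
by case: (i \in J); rewrite ?addr0 ?add0r.
Qed.

(** Positivity of [b_J] at [x - y]. *)
Lemma frame_op_le J x y :
  2 * rdot ip (S J x) y <= rdot ip (S J x) x + rdot ip (S J y) y.
Proof.
have := frame_op_ge0 J (x - y); rewrite frame_opD frame_opN.
rewrite !(rdotDl, rdotNl, rdotDr, rdotNr) (frame_op_sym J y x); lra.
Qed.

Lemma partial_form_le J x :
  rdot ip (S J x) x <= rdot ip (S setT x) x.
Proof.
have := frame_op_ge0 (~` J) x.
by have := rdotDl ip (S J x) (S (~` J) x) x; rewrite frame_opC /frame_op; lra.
Qed.

Lemma frame_form_le x : rdot ip (frame_op ip fr x) x <= B * rnorm x ^+ 2.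
Proof. by rewrite -lee_fin -sqcoef_sum_frame_op. Qed.

(** The form inequality at [B x] and [S x], whose mixed term is [B] times the
squared norm of [S x], together with the Bessel bound at both vectors. *)
Lemma rnorm_frame_op_le x :
  rnorm (frame_op ip fr x) ^+ 2 <= B ^+ 2 * rnorm x ^+ 2.
Proof.
set y := frame_op ip fr x.
have := frame_op_le setT (B%:C *: x) y; rewrite frame_opZ !rdotZl rdotZr.
rewrite -/(frame_op _ _ _) -/(frame_op _ _ _) -/y (rdotxx ip_norm).
have := frame_form_le x; have := frame_form_le y.
rewrite -/y => le_y le_x le_xy; rewrite -(ler_pM2l B_gt0); nra.
Qed.

(** * The frame operator, its inverse and the frame energy *)

Section LowerBound.
Variable A : R.
Hypotheses (A_gt0 : 0 < A) (A_le_B : A <= B).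
Hypothesis lower :
  forall x, A * rnorm x ^+ 2 <= rdot ip (frame_op ip fr x) x.

(** The squared norm of [x - t S x] is at most [1 - 2 t A + t^2 B^2] times that
of [x]; the factor is minimal, equal to [1 - (A / B)^2], at [t = A / B^2]. *)
Lemma frame_op_surj y : exists x, frame_op ip fr x = y.
Proof.
pose t := A / B ^+ 2; pose k := 1 - (A / B) ^+ 2.
have AB_gt0 : 0 < A / B by rewrite divr_gt0.
have AB_le1 : A / B <= 1 by rewrite ler_pdivrMr// mul1r.
have tE : t = A / B / B by rewrite /t expr2 invfM mulrA.
have t_gt0 : 0 < t by rewrite tE divr_gt0.
have tB : t * B = A / B by rewrite tE divfK// gt_eqF.
have tA : t * A = (A / B) ^+ 2.
  by rewrite expr2 -{1}tB -mulrA; congr (_ * _); rewrite mulrC divfK// gt_eqF.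
suff [x <-] : exists x, frame_op ip fr (t%:C *: x) = y by exists (t%:C *: x).
apply: (@surjective_near_id _ _ (fun x => frame_op ip fr (t%:C *: x))
  (Num.sqrt k)).
- by rewrite -sqrtr1 ltr_sqrt// /k; nra.
- by move=> x z /=; rewrite scalerDr; exact: frame_opD.
move=> x; rewrite [frame_op _ _ _]frame_opZ -/(frame_op _ _ _).
have k0 : 0 <= k by rewrite /k; nra.
rewrite -(@ler_pXn2r _ 2)// ?nnegrE ?mulr_ge0 ?rnorm_ge0 ?sqrtr_ge0//.
rewrite exprMn sqr_sqrtr// -(rdotxx ip_norm) !(rdotDl, rdotNl, rdotZl).
rewrite !(rdotDr, rdotNr, rdotZr) !(rdotxx ip_norm).
rewrite (rdotC ip x).
have := lower x; have := rnorm_frame_op_le x.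
set n := rnorm x ^+ 2; set m := rnorm _ ^+ 2; set b := rdot _ _ _ => m_le b_ge.
have tb : (A / B) ^+ 2 * n <= t * b by rewrite -tA; nra.
have tm : t ^+ 2 * m <= (A / B) ^+ 2 * n.
  by have := ler_wpM2l (sqr_ge0 t) m_le; rewrite -tB; lra.
by rewrite /k; lra.
Qed.

Lemma inv_frame_opK : cancel (inv_frame_op ip fr) (frame_op ip fr).
Proof.
move=> y; have [x xy] := frame_op_surj y.
by rewrite /inv_frame_op pinvK// inE -xy; exists x.
Qed.

Lemma frame_op_inj : injective (frame_op ip fr).
Proof.
move=> x y xy; apply/subr0_eq/rnorm0_eq0/eqP; rewrite -sqrf_eq0.
have := lower (x - y); rewrite [frame_op _ _ _]frame_opD frame_opN.
rewrite -!/(frame_op _ _ _) xy subrr /rdot linear0l.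
by rewrite pmulr_rle0// => le0; rewrite eq_le sqr_ge0 le0.
Qed.

(** [S u = S_J x] and [S v = S_J^c x] force [u + v = x], so that the energy of
[v] can be expanded around [x]. *)
Lemma energy_split J x u v :
  frame_op ip fr u = S J x -> frame_op ip fr v = S (~` J) x ->
  rdot ip (frame_op ip fr u) u + rdot ip (frame_op ip fr v) v =
  2 * rdot ip (frame_op ip fr u) u - 2 * rdot ip (S J x) x
    + rdot ip (frame_op ip fr x) x.
Proof.
move=> Su Sv; have uv : u + v = x.
  apply: frame_op_inj; rewrite [LHS]frame_opD -!/(frame_op _ _ _) Su Sv.
  exact: frame_opC.
have -> : v = x - u by rewrite -uv addrC addKr.
rewrite /frame_op frame_opD frame_opN !(rdotDl, rdotNl, rdotDr, rdotNr).
by rewrite (frame_op_sym setT x u) -/(frame_op ip fr u) Su; lra.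
Qed.

End LowerBound.

(** The energy of [u] is [b_J(x, u)], which positivity of [b_J] at [x - u]
bounds by the mean of [b_J(x, x)] and [b_J(u, u)]; the latter is at most the
energy. *)
Lemma energy_le J x u : frame_op ip fr u = S J x ->
  rdot ip (frame_op ip fr u) u <= rdot ip (S J x) x.
Proof.
move=> Su; have := frame_op_le J x u; have := partial_form_le J u.
by rewrite -/(frame_op ip fr u) Su; lra.
Qed.

(** The energy of [r x - u] is nonnegative. *)
Lemma energy_ge J x u r : frame_op ip fr u = S J x ->
  2 * r * rdot ip (S J x) x - r ^+ 2 * rdot ip (frame_op ip fr x) x
    <= rdot ip (frame_op ip fr u) u.
Proof.
move=> Su; have := frame_op_le setT (r%:C *: x) u.
rewrite frame_opZ !(rdotZl, rdotZr) (frame_op_sym setT x u).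
by rewrite -!/(frame_op _ _ _) Su; lra.
Qed.

End Bessel.

(** * The inequalities *)

Theorem corollary2p9 (R : realType) (H : completeNormedModType R[i])
    (ip : {dot H for Num.conj}) (ip_norm : induces_norm ip)
    (H_separable : separable_space H)
    (I : countType) (fr : I -> H) (fr_frame : is_frame ip fr)
    (lambda : R) (J : set I) (f : H) :
  let Sinv := inv_frame_op ip fr in
  let S_ := partial_frame_op ip fr in
  ((2 * lambda - lambda ^+ 2 / 2 - 1)%:E * sqcoef_sum ip fr J f
     + (1 - lambda ^+ 2 / 2)%:E * sqcoef_sum ip fr (~` J) f
   <= sqcoef_sum ip fr setT (Sinv (S_ J f))
     + sqcoef_sum ip fr setT (Sinv (S_ (~` J) f)))%E
  /\
  (sqcoef_sum ip fr setT (Sinv (S_ J f))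
     + sqcoef_sum ip fr setT (Sinv (S_ (~` J) f))
   <= sqcoef_sum ip fr setT f)%E.
Proof.
case: fr_frame => A [B [A_gt0 B_gt0 AB]].
(* B may be smaller than A when H is trivial; the upper bound A + B is not *)
have AB_gt0 : 0 < A + B by rewrite addr_gt0.
have A_le_AB : A <= A + B by rewrite lerDl ltW.
have bessel x : (sqcoef_sum ip fr setT x <= ((A + B) * rnorm x ^+ 2)%:E)%E.
  apply: le_trans (AB x).2 _; rewrite lee_fin ler_wpM2r ?sqr_ge0//.
  by rewrite lerDr ltW.
have sqE := sqcoef_sum_frame_op ip_norm AB_gt0 bessel.
have lower x : A * rnorm x ^+ 2 <= rdot ip (frame_op ip fr x) x.
  by have := (AB x).1; rewrite sqE lee_fin.
move=> Sinv S_; rewrite !sqE -!EFinM -!EFinD !lee_fin -!/(frame_op _ _ _).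
have SK := inv_frame_opK ip_norm AB_gt0 bessel A_gt0 A_le_AB lower.
have uS := SK (S_ J f).
have vS := SK (S_ (~` J) f).
rewrite (energy_split ip_norm AB_gt0 bessel A_gt0 lower uS vS).
have := energy_le ip_norm AB_gt0 bessel uS.
have := energy_ge ip_norm AB_gt0 bessel (lambda / 2) uS.
have := rdotDl ip (S_ J f) (S_ (~` J) f) f.
rewrite (frame_opC ip_norm AB_gt0 bessel) => ->.
by split; lra.
Qed.
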